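(* Let $m,n,p\in\mathbb{N}$, let $\Sigma=(A,B,C)\in V_{m,n,p}$ be a linear control system, and let $V_\Sigma\in\mathrm{rep}_\alpha Q$ be the associated representation of dimension vector $\alpha=(1,n)$ of the quiver $Q$ described in the context. (a) For $\theta_+=(-n,1)$ the following are equivalent: (1) $\Sigma$ is completely controllable; (2) $V_\Sigma$ is $\theta_+$-stable. (b) For $\theta_-=(n,-1)$ the following are equivalent: (1) $\Sigma$ is completely observable; (2) $V_\Sigma$ is $\theta_-$-stable.
   Context: $V_{m,n,p}=M_n(\mathbb{C})\times M_{n\times m}(\mathbb{C})\times M_{p\times n}(\mathbb{C})$. A system $\Sigma=(A,B,C)\in V_{m,n,p}$ is completely controllable if $c(\Sigma)=[\,B\ AB\ \cdots\ A^{n-1}B\,]$ has maximal rank $n$, and completely observable if the matrix $o(\Sigma)$ obtained by stacking $C,CA,\ldots,CA^{n-1}$ has maximal rank $n$. $Q$ is the quiver with two vertices (left and right), $m$ arrows $b_1,\ldots,b_m$ from left to right, $p$ arrows $c_1,\ldots,c_p$ from right to left, and one loop at the right vertex. $\mathrm{rep}_\alpha Q$ is the space of complex representations of dimension vector $\alpha=(1,n)$ (dimension $1$ at the left vertex, $n$ at the right vertex). $V_\Sigma$ assigns to $b_i$ the $i$-th column of $B$, to $c_j$ the $j$-th row of $C$, and to the loop the matrix $A$. For $\theta\in\mathbb{Z}^2$, a representation $V\in\mathrm{rep}_\alpha Q$ is $\theta$-stable if for every proper non-zero subrepresentation $W$ of $V$ one has $\theta.\beta>0$, where $\beta$ is the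 dimension vector of $W$ and $\theta.\beta$ is the standard inner product. *)

(* Defs.v *)
From HB Require Import structures.
From mathcomp Require Import all_boot all_order all_algebra.
From mathcomp Require Import complex reals.

Set Implicit Arguments.
Unset Strict Implicit.
Unset Printing Implicit Defensive.

Import Order.TTheory GRing.Theory Num.Theory.
Local Open Scope ring_scope.

Record quiver := Quiver {
  vertex : finType;
  arrow : finType;
  source : arrow -> vertex;
  target : arrow -> vertex
}.

(* The space at a vertex i is the space of column vectors 'cV[K]_(alpha i), on *)
(* which the matrices attached to the arrows act by left multiplication.       *)
Definition representation (K : fieldType) (Q : quiver) (alpha : vertex Q -> nat) :=
  forall a : arrow Q, 'M[K]_(alpha (target a), alpha (source a)).

Record subrepresentation (K : fieldType) (Q : quiver) (alpha : vertex Q -> nat)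
    (V : representation K alpha) := Subrepresentation {
  subspace : forall i : vertex Q, {vspace 'cV[K]_(alpha i)};
  subspace_stable : forall (a : arrow Q) (w : 'cV[K]_(alpha (source a))),
    w \in subspace (source a) -> V a *m w \in subspace (target a)
}.

Section Stability.
Variables (K : fieldType) (Q : quiver) (alpha : vertex Q -> nat).
Variable V : representation K alpha.

Definition sub_nonzero (W : subrepresentation V) : Prop :=
  exists i : vertex Q, subspace W i != 0%VS.

Definition sub_proper (W : subrepresentation V) : Prop :=
  exists i : vertex Q, subspace W i != fullv.

Definition dim_vector (W : subrepresentation V) (i : vertex Q) : nat :=
  \dim (subspace W i).

Definition weight_dot (theta : vertex Q -> int) (beta : vertex Q -> nat) : int :=
  \sum_(i : vertex Q) theta i * (beta i)%:Z.

Definition theta_stable (theta : vertex Q -> int) : Prop :=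
  forall W : subrepresentation V, sub_proper W -> sub_nonzero W ->
    0 < weight_dot theta (dim_vector W).

End Stability.

Record control_system (K : fieldType) (m n p : nat) := ControlSystem {
  sysA : 'M[K]_n;
  sysB : 'M[K]_(n, m);
  sysC : 'M[K]_(p, n)
}.

Section ControlSystems.
Variables (K : fieldType) (m n p : nat).
Implicit Type S : control_system K m n p.

Definition controllability_mx S :=
  \mxrow_(k < n) (sysA S ^+ k *m sysB S).

Definition observability_mx S :=
  \mxcol_(k < n) (sysC S *m sysA S ^+ k).

Definition completely_controllable S : Prop := \rank (controllability_mx S) = n.

Definition completely_observable S : Prop := \rank (observability_mx S) = n.

(* The two vertices are the booleans: false is the left one, true the right.   *)
Definition at_vertices (T : Type) (x y : T) (i : bool) : T := if i then y else x.

(* inl (inl i) is the arrow b_i, inl (inr j) is c_j, and inr tt is the loop.   *)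
Definition sys_arrow : finType := (('I_m + 'I_p) + unit)%type.

Definition sys_source (a : sys_arrow) : bool :=
  match a with inl (inl _) => false | inl (inr _) => true | inr _ => true end.

Definition sys_target (a : sys_arrow) : bool :=
  match a with inl (inl _) => true | inl (inr _) => false | inr _ => true end.

Definition sys_quiver : quiver :=
  @Quiver bool sys_arrow sys_source sys_target.

Definition sys_dim : vertex sys_quiver -> nat := at_vertices 1%N n.

Definition sys_rep S : representation K sys_dim :=
  fun a : sys_arrow =>
    match a return 'M[K]_(sys_dim (sys_target a), sys_dim (sys_source a)) with
    | inl (inl i) => col i (sysB S)
    | inl (inr j) => row j (sysC S)
    | inr _ => sysA S
    end.

Definition theta_plus : vertex sys_quiver -> int := at_vertices (- n%:Z) 1.

Definition theta_minus : vertex sys_quiver -> int := at_vertices n%:Z (- 1).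

End ControlSystems.

Arguments theta_plus {m} n {p} _.
Arguments theta_minus {m} n {p} _.

(* Main.v *)
Require Import Defs.
From mathcomp Require Import all_boot all_order all_algebra.
From mathcomp Require Import complex reals.
Set Implicit Arguments.
Unset Strict Implicit.
Import Order.TTheory GRing.Theory Num.Theory.
Local Open Scope ring_scope.

(** The theorem holds over any field.  Both sides of each equivalence say the
    same thing about the subspaces U of the state space that are stable under A:
    - in (a), that the only such U containing every column of B is the whole
      space;
    - in (b), that the only such U contained in the kernel of C is 0.

    On the stability side ([theta_plus_stableP], [theta_minus_stableP]), a
    subrepresentation is a pair (L, U) with L a subspace of the line at the left
    vertex and U stable under A, linked by B(L) <= U and C(U) <= L.  The line
    leaves only L = 0 and L = line.  For theta_+ the weight is dim U when L = 0,
    positive unless the pair is zero; when L = line it is dim U - n, never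
    positive.  So stability forbids exactly the pairs (line, U) with U a proper
    subspace, and there the condition on C is void while the one on B says that
    U contains the columns of B.  For theta_- the weights are n - dim U and
    - dim U, and stability forbids exactly the pairs (0, U) with U nonzero, for
    which the condition on B is void and U lies in the kernel of C.

    On the rank side ([controllableP], [observableP]), the column space of the
    controllability matrix is the least A-stable subspace containing the columns
    of B, and the kernel of the observability matrix is the greatest A-stable
    subspace contained in the kernel of C.  Both facts rest on the
    Cayley-Hamilton theorem: only the powers A^k with k < n occur in the
    matrices, and it is A^n being a combination of them that makes the column
    space and the kernel stable under A. *)

(** * Powers of a matrix and stable subspaces *)

(** This is Cayley-Hamilton, read as a formula for the leading term of the
    characteristic polynomial evaluated at A. *)
Lemma expmx_span (K : fieldType) (n : nat) (A : 'M[K]_n) :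
  exists c : 'I_n -> K, A ^+ n = \sum_(i < n) c i *: A ^+ i.
Proof.
case: n A => [|n] A; first by exists (fun=> 0); apply/matrixP; case.
exists (fun i => - (char_poly A)`_i).
have chp : char_poly A = \sum_(i < n.+1) (char_poly A)`_i *: 'X^i + 'X^(n.+1).
  rewrite -{1}[char_poly A]coefK size_char_poly poly_def big_ord_recr /=.
  have lead1 : (char_poly A)`_n.+1 = 1.
    by rewrite -(monicP (char_poly_monic A)) lead_coefE size_char_poly.
  by rewrite lead1 scale1r.
have := Cayley_Hamilton A.
rewrite [X in horner_mx A X]chp rmorphD rmorph_sum rmorphXn /= horner_mx_X.
rewrite addrC => /eqP; rewrite addr_eq0 => /eqP ->.
rewrite -sumrN; apply: eq_bigr => i _.
by rewrite linearZ /= rmorphXn /= horner_mx_X scaleNr.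
Qed.

Definition mx_stable (K : fieldType) (n : nat) (A : 'M[K]_n)
    (U : {vspace 'cV[K]_n}) : Prop :=
  forall u, u \in U -> A *m u \in U.

Lemma mx_stable_exp (K : fieldType) (n : nat) (A : 'M[K]_n) U k u :
  mx_stable A U -> u \in U -> A ^+ k *m u \in U.
Proof.
move=> sU Uu; elim: k => [|k IH]; first by rewrite expr0 mul1mx.
by rewrite exprS -mulmxA sU.
Qed.

(** The form in which Cayley-Hamilton is applied below, with U the column space
    of the controllability matrix in one case and the kernel of C in the other:
    these need to be reached by A^n u as well as by the lower powers. *)
Lemma expmx_mul_mem (K : fieldType) (n : nat) (A : 'M[K]_n)
    (U : {vspace 'cV[K]_n}) (u : 'cV[K]_n) (k : nat) :
  (forall i : 'I_n, A ^+ i *m u \in U) -> (k <= n)%N -> A ^+ k *m u \in U.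
Proof.
move=> Uu; rewrite leq_eqVlt => /predU1P[->|lt_kn]; last exact: Uu (Ordinal _).
have [c ->] := expmx_span A.
rewrite mulmx_suml; apply: memv_suml => i _.
by rewrite -scalemxAl memvZ.
Qed.

Lemma mulmx_mem (K : fieldType) (m n : nat) (U : {vspace 'cV[K]_n})
    (M : 'M[K]_(n, m)) (x : 'cV[K]_m) :
  (forall i, col i M \in U) -> M *m x \in U.
Proof.
move=> UM.
have -> : M *m x = \sum_i x i 0 *: col i M.
  apply/colP=> j; rewrite mxE summxE; apply: eq_bigr => i _.
  by rewrite !mxE mulrC.
by apply: memv_suml => i _; apply: memvZ.
Qed.

(** * Rank conditions in terms of stable subspaces *)

Section ControlSystems.
Variables (K : fieldType) (m n p : nat).
Variable S : control_system K m n p.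

Lemma mul_controllability_mx (x : 'I_n -> 'cV[K]_m) :
  controllability_mx S *m (\mxcol_k x k) =
    \sum_(k < n) sysA S ^+ k *m (sysB S *m x k).
Proof.
by rewrite mul_mxrow_mxcol; apply: eq_bigr => k _; rewrite mulmxA.
Qed.

(** If the rank is n, every vector is a sum of terms A^k B x, and these lie in
    any A-stable U containing the columns of B.  Conversely the column space of
    the controllability matrix is itself such a U, so it is everything. *)
Lemma controllableP :
  completely_controllable S <->
  forall U : {vspace 'cV[K]_n}, mx_stable (sysA S) U ->
    (forall i, col i (sysB S) \in U) -> U = fullv.
Proof.
split=> [/eqP/row_freeP[X MX1] U sU UB | fullU].
  apply/vspaceP=> v; rewrite memvf -[v]mul1mx -MX1 -mulmxA.
  rewrite -[X *m v]submxcolK mul_controllability_mx.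
  apply: memv_suml => k _; apply: mx_stable_exp => //; exact: mulmx_mem.
pose f := linfun (mulmx (controllability_mx S) : 'cV[K]_ _ -> 'cV[K]_n).
have ABf (k : 'I_n) (y : 'cV_m) : sysA S ^+ k *m (sysB S *m y) \in limg f.
  apply/memv_imgP; exists (\mxcol_j (if j == k then y else 0)).
    exact: memvf.
  rewrite lfunE /= mul_controllability_mx (bigD1 k) //= eqxx.
  rewrite big1 ?addr0 // => j.
  by move=> /negPf->; rewrite !mulmx0.
(* Exponent n is included since multiplying by A shifts every exponent by 1. *)
have ABf' k y : (k <= n)%N -> sysA S ^+ k *m (sysB S *m y) \in limg f.
  by move=> ?; apply: expmx_mul_mem.
have limg_full : limg f = fullv.
  apply: fullU => [_ /memv_imgP[x _ ->] | i].
    rewrite lfunE /= -[x]submxcolK mul_controllability_mx mulmx_sumr.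
    by apply: memv_suml => k _; rewrite mulmxA -[sysA S *m _]exprS ABf'.
  by rewrite colE -[_ *m _]mul1mx -[1%:M]/(sysA S ^+ 0) ABf'.
(* A row vector killing the matrix kills its column space, hence each delta. *)
apply/eqP/inj_row_free => u uM0; apply/rowP=> i; rewrite mxE.
have /memv_imgP[x _ Dx] : delta_mx i 0 \in limg f by rewrite limg_full memvf.
have := congr1 (mulmx u) Dx; rewrite lfunE /= mulmxA uM0 mul0mx -colE.
by move/matrixP/(_ 0 0); rewrite !mxE.
Qed.

Lemma mul_observability_mx_eq0 (v : 'cV[K]_n) :
  observability_mx S *m v = 0 <->
  forall k : 'I_n, sysC S *m (sysA S ^+ k *m v) = 0.
Proof.
rewrite mxcol_mul -[X in _ = X]mxcol0; split=> [/eq_mxcolP E k | E].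
  by rewrite mulmxA E.
by apply/eq_mxcolP => k; rewrite -mulmxA E.
Qed.

(** If the rank is n, the observability matrix is injective; it kills any
    A-stable U inside the kernel of C, so U is 0.  Conversely the kernel of the
    observability matrix is itself such a U, so it is 0. *)
Lemma observableP :
  completely_observable S <->
  forall U : {vspace 'cV[K]_n}, mx_stable (sysA S) U ->
    (forall u, u \in U -> sysC S *m u = 0) -> U = 0%VS.
Proof.
split=> [rankO U sU UC | U0].
  have /row_freeP[X OX1] : row_free (observability_mx S)^T.
    by rewrite /row_free mxrank_tr; apply/eqP.
  apply/eqP; rewrite -subv0; apply/subvP=> u Uu; rewrite memv0.
  have Ou0 : observability_mx S *m u = 0.
    by apply/mul_observability_mx_eq0 => k; apply/UC/mx_stable_exp.
  by rewrite -[u]mul1mx -trmx1 -OX1 trmx_mul trmxK -mulmxA Ou0 mulmx0.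
pose f := linfun (mulmx (observability_mx S) : 'cV[K]_n -> 'cV[K]_ _).
pose g := linfun (mulmx (sysC S) : 'cV[K]_n -> 'cV[K]_p).
have kerfE v : v \in lker f <-> forall k : 'I_n, sysA S ^+ k *m v \in lker g.
  rewrite memv_ker lfunE /=; split=> [/eqP/mul_observability_mx_eq0 E k | E].
    by rewrite memv_ker lfunE /= E.
  apply/eqP/mul_observability_mx_eq0 => k; apply/eqP.
  by have := E k; rewrite memv_ker lfunE.
(* Stability of the kernel under A needs C A^n u = 0, and its inclusion in the
   kernel of C needs C A^0 u = 0, which for n = 0 is again an exponent equal to
   n and not below it. *)
have ker0 : lker f = 0%VS.
  apply: U0 => u /kerfE Au.
    apply/kerfE=> k; rewrite mulmxA -[_ *m sysA S]exprSr.
    exact: expmx_mul_mem.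
  have := expmx_mul_mem Au (leq0n n).
  by rewrite expr0 mul1mx memv_ker lfunE => /eqP.
rewrite /completely_observable -mxrank_tr.
apply/eqP/inj_row_free => u uO0.
have Ou0 : observability_mx S *m u^T = 0.
  by apply: trmx_inj; rewrite trmx_mul trmxK trmx0.
apply/eqP; rewrite -trmx_eq0 -memv0 -ker0.
by rewrite memv_ker lfunE /= Ou0.
Qed.

(** * Stability conditions in terms of stable subspaces *)

Lemma weight_dot_sys_quiver (theta : vertex (sys_quiver m p) -> int)
    (beta : vertex (sys_quiver m p) -> nat) :
  weight_dot theta beta =
    theta true * (beta true)%:Z + theta false * (beta false)%:Z.
Proof. by rewrite /weight_dot big_bool. Qed.

Definition sys_subspaces (L : {vspace 'cV[K]_1}) (U : {vspace 'cV[K]_n})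
    (i : vertex (sys_quiver m p)) : {vspace 'cV[K]_(sys_dim n i)} :=
  match i with false => L | true => U end.

Lemma sys_subspaces_stable (L : {vspace 'cV[K]_1}) (U : {vspace 'cV[K]_n}) :
  mx_stable (sysA S) U ->
  (forall i (w : 'cV_1), w \in L -> col i (sysB S) *m w \in U) ->
  (forall j (u : 'cV_n), u \in U -> row j (sysC S) *m u \in L) ->
  forall (a : arrow (sys_quiver m p)) (w : 'cV_(sys_dim n (source a))),
    w \in sys_subspaces L U (source a) ->
    sys_rep S a *m w \in sys_subspaces L U (target a).
Proof. by move=> UA LB UC [[i|j]|[]] w /=; [apply: LB|apply: UC|apply: UA]. Qed.


Definition sys_subrep L U UA LB UC : subrepresentation (sys_rep S) :=
  Subrepresentation (@sys_subspaces_stable L U UA LB UC).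

Lemma vspace_cV1 (L : {vspace 'cV[K]_1}) : L = 0%VS \/ L = fullv.
Proof.
have [->|nzL] := eqVneq L 0%VS; [by left | right].
apply/eqP; rewrite eqEdim subvf dimvf dim_matrix.
by rewrite -dimv_eq0 in nzL; rewrite lt0n.
Qed.

(** The subrepresentations that matter are those with the whole line at the left
    vertex, since their weight dim U - n is never positive. *)
Lemma theta_plus_stableP :
  theta_stable (sys_rep S) (theta_plus n) <->
  forall U : {vspace 'cV[K]_n}, mx_stable (sysA S) U ->
    (forall i, col i (sysB S) \in U) -> U = fullv.
Proof.
split=> [stabV U UA UB | fullU W properW nzW].
  have LB (i : 'I_m) (w : 'cV_1) : w \in fullv -> col i (sysB S) *m w \in U.
    by move=> _; rewrite (mx11_scalar w) mul_mx_scalar memvZ.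
  have LC (j : 'I_p) (u : 'cV_n) : u \in U -> row j (sysC S) *m u \in fullv.
    by rewrite memvf.
  apply/eqP; apply: contraT => properU.
  have : 0 < weight_dot (theta_plus n) (dim_vector (sys_subrep UA LB LC)).
    apply: stabV; first by exists true.
    by exists false; rewrite -dimv_eq0 /= dimvf dim_matrix.
  rewrite weight_dot_sys_quiver /dim_vector /=.
  rewrite dimvf dim_matrix mul1r mulr1 subr_gt0 ltz_nat.
  have := dimvS (subvf U); rewrite dimvf dim_matrix mulr1.
  by rewrite leqNgt => /negPf->.
have WA : mx_stable (sysA S) (subspace W true : {vspace 'cV_n}).
  move=> u; exact: (@subspace_stable _ _ _ _ W (inr tt : sys_arrow m p) u).
rewrite weight_dot_sys_quiver /dim_vector.
have [W0|Wfull] := vspace_cV1 (subspace W false).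
  rewrite W0 dimv0 mulr0 addr0 mul1r ltz_nat lt0n dimv_eq0.
  by case: nzW => [[]] //; rewrite W0 eqxx.
have UB i : col i (sysB S) \in (subspace W true : {vspace 'cV_n}).
  have := @subspace_stable _ _ _ _ W (inl (inl i) : sys_arrow m p)
    (1%:M : 'cV_1).
  by rewrite /= mulmx1 Wfull memvf; apply.
by case: properW => [[]]; rewrite ?Wfull ?(fullU _ WA UB) eqxx.
Qed.

(** The subrepresentations that matter are those with 0 at the left vertex,
    since their weight - dim U is never positive. *)
Lemma theta_minus_stableP :
  theta_stable (sys_rep S) (theta_minus n) <->
  forall U : {vspace 'cV[K]_n}, mx_stable (sysA S) U ->
    (forall u, u \in U -> sysC S *m u = 0) -> U = 0%VS.
Proof.
split=> [stabV U UA UC | U0 W properW nzW].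
  have LB (i : 'I_m) (w : 'cV_1) : w \in 0%VS -> col i (sysB S) *m w \in U.
    by rewrite memv0 => /eqP->; rewrite mulmx0 mem0v.
  have LC (j : 'I_p) (u : 'cV_n) : u \in U -> row j (sysC S) *m u \in 0%VS.
    by move=> Uu; rewrite -row_mul UC // row0 mem0v.
  apply/eqP; apply: contraT => nzU.
  have : 0 < weight_dot (theta_minus n) (dim_vector (sys_subrep UA LB LC)).
    apply: stabV; last by exists true.
    by exists false; rewrite /= eq_sym -dimv_eq0 dimvf dim_matrix.
  rewrite weight_dot_sys_quiver /dim_vector /=.
  by rewrite dimv0 mulr0 addr0 mulN1r oppr_gt0 ltNge lez_nat.
have WA : mx_stable (sysA S) (subspace W true : {vspace 'cV_n}).
  move=> u; exact: (@subspace_stable _ _ _ _ W (inr tt : sys_arrow m p) u).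
rewrite weight_dot_sys_quiver /dim_vector.
have [W0|Wfull] := vspace_cV1 (subspace W false).
  have UC (u : 'cV_n) :
      u \in (subspace W true : {vspace 'cV_n}) -> sysC S *m u = 0.
    move=> Uu; apply/row_matrixP => j; rewrite row_mul row0; apply/eqP.
    rewrite -memv0 -W0.
    by rewrite (@subspace_stable _ _ _ _ W (inl (inr j) : sys_arrow m p)).
  by case: nzW => [[]]; rewrite ?W0 ?(U0 _ WA UC) eqxx.
rewrite Wfull dimvf dim_matrix mulr1 mulN1r addrC subr_gt0 ltz_nat.
have properU : subspace W true != fullv.
  by case: properW => [[]] //; rewrite Wfull eqxx.
move: properU; rewrite eqEdim subvf dimvf dim_matrix -ltnNge.
by rewrite mulr1.
Qed.

End ControlSystems.

Theorem lemma2 (R : realType) (m n p : nat)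
    (S : control_system (complex R) m n p) :
  (completely_controllable S <-> theta_stable (sys_rep S) (theta_plus n)) /\
  (completely_observable S <-> theta_stable (sys_rep S) (theta_minus n)).
Proof.
split.
- exact: iff_trans (controllableP S) (iff_sym (theta_plus_stableP S)).
- exact: iff_trans (observableP S) (iff_sym (theta_minus_stableP S)).
Qed.
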